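(* Let $m$ be a positive integer and $B_n = \frac{n p_n}{2} - \sum_{k \le n} p_k$. Then, as $n \to \infty$, \[ B_n = \frac{n^2}{4} + \frac{n^2}{2}\,h_m(n) + \frac{n^2}{2}\sum_{s=1}^m \frac{(-1)^s}{s\log^sn} \sum_{i=0}^s a_{is} \sum_{j=1}^{m-s} \sum_{r=0}^{\min\{i,j\}} \frac{b_{s,i,j,r}(\log \log n)^{i-r}}{2^j\log^jn} + O (n c_m(n)). \]
   Context: $p_k$ denotes the $k$-th prime ($p_1 = 2$), $\log$ is the natural logarithm. Define $h_m(n) = \sum_{j=1}^m \frac{(j-1)!}{2^j \log^j n}$ and $c_m(n) = \frac{n(\log\log n)^{m+1}}{\log^{m+1} n}$. The rational numbers $a_{is}$ ($0 \le i \le s$, $1\le s\le m$) are the uniquely determined rationals with $a_{ss}=1$ such that (Cipolla's expansion) $p_n = n\left( \log n + \log \log n - 1 + \sum_{s=1}^m \frac{(-1)^{s+1}}{s\log^s n} \sum_{i=0}^s a_{is}(\log \log n)^i \right) + O\left( \frac{n (\log \log n)^{m+1}}{\log^{m+1}n} \right)$. For $s,i,j,r \in \mathbb{N}_0$ with $j \ge r$, the integers $b_{s,i,j,r}$ are defined recursively by: $b_{s,i,0,0} = 1$; for $j \ge 1$, $b_{s,i,j,j} = b_{s,i,j-1,j-1}\cdot(-i+j-1)$ and $b_{s,i,j,0} = b_{s,i,j-1,0}\cdot(s+j-1)$; for $j > r \ge 1$, $b_{s,i,j,r} = b_{s,i,j-1,r}\cdot(s+j-1) + b_{s,i,j-1,r-1}\cdot(-i+r-1)$.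 *)

(* Defs.v *)
From HB Require Import structures.
From mathcomp Require Import all_boot all_order all_algebra.
From mathcomp Require Import all_classical all_reals all_analysis.

Set Implicit Arguments.
Unset Strict Implicit.
Unset Printing Implicit Defensive.

Import Order.TTheory GRing.Theory Num.Theory.
Import numFieldNormedType.Exports.

Local Open Scope classical_set_scope.
Local Open Scope ring_scope.

Lemma ex_prime_gt (n : nat) : exists p, (n < p)%N && prime p.
Proof. by have [p lt_np pr_p] := prime_above n; exists p; rewrite lt_np. Qed.

Definition next_prime (n : nat) : nat := ex_minn (ex_prime_gt n).

(* nth_prime 1 = 2; the value nth_prime 0 = 0 is a dummy. *)
Definition nth_prime (k : nat) : nat := iter k next_prime 0%N.

Definition B_seq (R : realType) (n : nat) : R :=
  n%:R * (nth_prime n)%:R / 2 - \sum_(1 <= k < n.+1) (nth_prime k)%:R.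

Definition h_sum (R : realType) (m n : nat) : R :=
  \sum_(1 <= j < m.+1) (j.-1)`!%:R / (2 ^+ j * ln n%:R ^+ j).

Definition c_err (R : realType) (m n : nat) : R :=
  n%:R * ln (ln n%:R) ^+ m.+1 / ln n%:R ^+ m.+1.

(* The values for j < r are dummies, set to 0. *)
Fixpoint b_coef (s i j r : nat) {struct j} : int :=
  match j, r with
  | 0, 0 => 1
  | 0, _.+1 => 0
  | j'.+1, 0 => b_coef s i j' 0 * (s%:Z + j'%:Z)
  | j'.+1, r'.+1 =>
      if r' == j' then b_coef s i j' j' * (- i%:Z + j'%:Z)
      else if (r' < j')%N then
        b_coef s i j' r'.+1 * (s%:Z + j'%:Z) + b_coef s i j' r' * (- i%:Z + r'%:Z)
      else 0
  end.

(* The argument order is that of the subscripts of a_{is}. Coefficients       *)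
(* outside the range 0 <= i <= s, 1 <= s <= m are irrelevant; those within it *)
(* are uniquely determined by this property, which is how Cipolla's           *)
(* coefficients are defined.                                                  *)
Definition cipolla_coefficients (R : realType) (m : nat)
    (a : nat -> nat -> rat) : Prop :=
  (forall s, (1 <= s <= m)%N -> a s s = 1) /\
  (fun n => (nth_prime n)%:R : R) =
  (fun n => n%:R * (ln n%:R + ln (ln n%:R) - 1
     + \sum_(1 <= s < m.+1) (-1) ^+ s.+1 / (s%:R * ln n%:R ^+ s)
         * \sum_(0 <= i < s.+1) ratr (a i s) * ln (ln n%:R) ^+ i))
  +O_\oo (fun n => c_err R m n).

(* Main.v *)
(** Put L = ln n, l = ln (ln n), theta = x d/dx.  Cipolla's expansion reads
    p_n = n phi(n) + O(c_m(n)), where phi is a combination of the functions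
    l^i L^(1-s).  If Psi + theta Psi / 2 = phi up to O(l^(m+1) / L^(m+1)), then
    G(x) = x^2 Psi(x) / 2 satisfies G' = x phi up to O(c_m(x)); by the mean value
    theorem G(k+1) - G(k) = p_(k+1) + O(c_m(k+1)), and since c_m is eventually
    nondecreasing, summation gives the sum of the p_k as G(n) + O(n c_m(n)).  Hence
    B_n = n^2 (phi - Psi) / 2 + O(n c_m(n)).  For phi = T_0 a suitable Psi is the
    truncated Neumann series of (1 + theta/2)^(-1), the sum of T_j / 2^j with
    T_j = (-theta)^j T_0; the b_{s,i,j,r} are the coefficients of T_j when
    T_0 = l^i / L^s. *)
Require Import Defs.
From HB Require Import structures.
From mathcomp Require Import all_boot all_order all_algebra.
From mathcomp Require Import all_classical all_reals all_analysis.
From mathcomp Require Import ring lra.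

Import Order.TTheory GRing.Theory Num.Theory.
Import numFieldNormedType.Exports.

Local Open Scope classical_set_scope.
Local Open Scope ring_scope.

(** * Monomials in ln x and ln (ln x), and their logarithmic derivatives *)

(* Writing L = ln x and l = ln (ln x), the function [loglog_mono i s] is
   l^i * L^(1-s); the shift by one lets L itself occur with s a natural number. *)
Definition loglog_mono (R : realType) (i s : nat) (x : R) : R :=
  ln (ln x) ^+ i * (ln x / ln x ^+ s).

(** The threshold e^e ensures ln (ln x) >= 1, so that raising the exponent of ln (ln x) never makes
    a monomial smaller. *)
Definition ee (R : realType) : R := expR (expR 1).

Lemma ee_le (R : realType) (x : R) :
  ee R <= x -> [/\ 0 < x, 1 < ln x & 1 <= ln (ln x)].
Proof.
move=> hx.
have x0 : 0 < x by exact: lt_le_trans (expR_gt0 _) hx.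
have hL : expR 1 <= ln x by rewrite -ler_expR lnK.
have L1 : 1 < ln x by apply: lt_le_trans hL; rewrite expR_gt1.
by split => //; rewrite -ler_expR lnK // posrE (lt_trans ltr01 L1).
Qed.

Lemma loglog_monoS (R : realType) (i s : nat) (x : R) : ee R <= x ->
  loglog_mono R i s.+1 x = ln (ln x) ^+ i / ln x ^+ s.
Proof.
move=> /ee_le[_ L1 _]; have L0 : ln x != 0 by rewrite gt_eqF // (lt_trans ltr01).
by rewrite /loglog_mono exprS; field; rewrite expf_neq0 L0.
Qed.

(* [Q] is the logarithmic derivative x P'(x), for large x. *)
Definition is_euler_derive (R : realType) (P Q : R -> R) :=
  forall x, ee R <= x -> is_derive x 1 P (Q x / x).

(** Product rule with theta L = 1 and theta l = 1/L. For i = 0 the truncated [i.-1] is harmless,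
    since its factor i is zero. *)
Lemma is_euler_derive_loglog_mono (R : realType) (i s : nat) :
  is_euler_derive R (loglog_mono R i s) (fun x =>
    i%:R * loglog_mono R i.-1 s.+1 x + (1 - s%:R) * loglog_mono R i s.+1 x).
Proof.
move=> x /ee_le[x0 L1 l1].
have L0 : 0 < ln x by exact: lt_trans L1.
have dL : is_derive x 1 (@ln R) x^-1 by exact: is_derive1_ln.
have dl : is_derive x 1 (@ln R \o @ln R) ((ln x)^-1 * x^-1).
  exact: is_derive1_comp (is_derive1_ln L0) dL.
have Ln0 : ln x != 0 by rewrite gt_eqF.
have xn0 : x != 0 by rewrite gt_eqF.
have dV := is_deriveV Ln0 dL.
have H := is_deriveM (is_deriveX i dl) (is_deriveM dL (is_deriveX s dV)).
rewrite (_ : loglog_mono R i s = ((@ln R \o @ln R) ^+ i *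
   (@ln R * (fun y => (ln y)^-1) ^+ s))); last first.
  by apply/funext => y; rewrite /loglog_mono !fctE /= exprVn.
apply: (is_derive_eq H) => {H}.
rewrite !fctE /= /loglog_mono /GRing.scale /=.
case: s => [|s]; case: i => [|i] /=; rewrite ?exprVn ?exprS ?expr0 ?expr1;
  field; by rewrite ?expf_neq0 ?Ln0 ?xn0.
Qed.

Lemma is_euler_deriveD (R : realType) (P P' Q Q' : R -> R) :
  is_euler_derive R P Q -> is_euler_derive R P' Q' ->
  is_euler_derive R (fun x => P x + P' x) (fun x => Q x + Q' x).
Proof.
move=> h h' x hx; apply: (is_derive_eq (is_deriveD (h x hx) (h' x hx))).
by rewrite mulrDl.
Qed.

Lemma is_euler_deriveZ (R : realType) (k : R) (P Q : R -> R) :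
  is_euler_derive R P Q -> is_euler_derive R (fun x => k * P x) (fun x => k * Q x).
Proof.
move=> h x hx; apply: (is_derive_eq (is_deriveZ k (h x hx))).
by rewrite /GRing.scale /= mulrA.
Qed.

(** * Domination by a nonnegative function from e^e on *)

(* Eventual domination, with the threshold fixed once and for all so that it is
   stable under finite sums. *)
Definition dominated (R : realType) (P E : R -> R) :=
  exists C : R, 0 <= C /\ forall x, ee R <= x -> `|P x| <= C * E x.

Lemma dominatedD (R : realType) (P Q E : R -> R) :
  dominated R P E -> dominated R Q E -> dominated R (fun x => P x + Q x) E.
Proof.
move=> [C [C0 hC]] [D [D0 hD]]; exists (C + D); split; first exact: addr_ge0.
move=> x hx; rewrite mulrDl; apply: le_trans (ler_normD _ _) _.
by apply: lerD; [exact: hC|exact: hD].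
Qed.

Lemma dominatedZ (R : realType) (k : R) (P E : R -> R) :
  dominated R P E -> dominated R (fun x => k * P x) E.
Proof.
move=> [C [C0 hC]]; exists (`|k| * C); split; first by rewrite mulr_ge0.
by move=> x hx; rewrite normrM -mulrA ler_wpM2l // hC.
Qed.

Lemma dominated_sum (R : realType) (I : eqType) (r : seq I)
    (P : I -> R -> R) (E : R -> R) :
  (forall x, ee R <= x -> 0 <= E x) ->
  (forall i, i \in r -> dominated R (P i) E) ->
  dominated R (fun x => \sum_(i <- r) P i x) E.
Proof.
move=> E0; elim: r => [|i r IH] h.
  by exists 0; split => // x hx; rewrite big_nil normr0 mul0r.
under eq_fun do rewrite big_cons.
apply: dominatedD; first by apply: h; rewrite mem_head.
by apply: IH => j jr; apply: h; rewrite in_cons jr orbT.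
Qed.

Lemma loglog_mono_ge0 (R : realType) (i s : nat) (x : R) :
  ee R <= x -> 0 <= loglog_mono R i s x.
Proof.
move=> /ee_le[x0 L1 l1].
by rewrite /loglog_mono !mulr_ge0 ?invr_ge0 ?exprn_ge0 // (le_trans ler01) // ltW.
Qed.

Lemma dominated_loglog_mono (R : realType) (i s i' s' : nat) :
  (i <= i')%N -> (s' <= s)%N ->
  dominated R (loglog_mono R i s) (loglog_mono R i' s').
Proof.
move=> ii ss; exists 1; split => // x hx.
rewrite mul1r ger0_norm ?loglog_mono_ge0 //; have [x0 L1 l1] := ee_le _ _ hx.
have L0 : 0 < ln x := lt_trans ltr01 L1.
have l0 : 0 <= ln (ln x) := le_trans ler01 l1.
rewrite /loglog_mono ler_pM ?exprn_ge0 ?divr_ge0 ?(ltW L0) ?exprn_ge0 ?(ltW L0) //.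
  exact: ler_weXn2l.
rewrite ler_pM2l // lef_pV2 ?posrE ?exprn_gt0 //.
by rewrite ler_weXn2l // ltW.
Qed.

(** Since l <= L, one has l^i L^(1-s) <= L^(1+i-s) <= L. *)
Lemma dominated_loglog_mono_ln (R : realType) (i s : nat) :
  (i <= s)%N -> dominated R (loglog_mono R i s) (loglog_mono R 0 0).
Proof.
move=> ls; exists 1; split => // x hx.
rewrite mul1r ger0_norm ?loglog_mono_ge0 //; have [x0 L1 l1] := ee_le _ _ hx.
have L0 : 0 < ln x := lt_trans ltr01 L1.
have l0 : 0 <= ln (ln x) := le_trans ler01 l1.
rewrite /loglog_mono expr0 mul1r divr1 mulrCA ler_piMr ?(ltW L0) //.
rewrite ler_pdivrMr ?exprn_gt0 // mul1r.
apply: (@le_trans _ _ (ln x ^+ i)).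
  rewrite lerXn2r ?nnegrE ?(ltW L0) //.
  have := expR_ge1Dx (ln (ln x)); rewrite lnK ?posrE //; lra.
by rewrite ler_weXn2l // ltW.
Qed.

(** * Approximate primitives of x phi(x), and their linearity *)

(* Up to an error x E(x), the derivative of x^2 Psi(x) / 2 is x phi(x); the bounds
   by ln on phi and dphi make the variation of x phi(x) on unit intervals O(ln x). *)
Definition half_square_primitive (R : realType) (E phi Psi : R -> R) :=
  exists dphi dPsi, [/\ is_euler_derive R phi dphi, is_euler_derive R Psi dPsi,
    dominated R phi (loglog_mono R 0 0), dominated R dphi (loglog_mono R 0 0) &
    dominated R (fun x => Psi x + dPsi x / 2 - phi x) E].

Lemma half_square_primitiveD (R : realType) (E phi Psi phi' Psi' : R -> R) :
  half_square_primitive R E phi Psi -> half_square_primitive R E phi' Psi' ->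
  half_square_primitive R E (fun x => phi x + phi' x) (fun x => Psi x + Psi' x).
Proof.
move=> [f [g [hf hg bf bdf be]]] [f' [g' [hf' hg' bf' bdf' be']]].
exists (fun x => f x + f' x), (fun x => g x + g' x); split.
- exact: is_euler_deriveD.
- exact: is_euler_deriveD.
- exact: dominatedD.
- exact: dominatedD.
- rewrite (_ : (fun x => _) = (fun x => (Psi x + g x / 2 - phi x) +
    (Psi' x + g' x / 2 - phi' x))); first exact: dominatedD.
  by apply/funext => x; field.
Qed.

Lemma half_square_primitiveZ (R : realType) (k : R) (E phi Psi : R -> R) :
  half_square_primitive R E phi Psi ->
  half_square_primitive R E (fun x => k * phi x) (fun x => k * Psi x).
Proof.
move=> [f [g [hf hg bf bdf be]]].
exists (fun x => k * f x), (fun x => k * g x); split.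
- exact: is_euler_deriveZ.
- exact: is_euler_deriveZ.
- exact: dominatedZ.
- exact: dominatedZ.
- rewrite (_ : (fun x => _) = (fun x => k * (Psi x + g x / 2 - phi x))).
    exact: dominatedZ.
  by apply/funext => x; field.
Qed.

Lemma big_cons_fun (R : realType) (I : Type) (i : I) (r : seq I) (P : I -> R -> R) :
  (fun x => \sum_(j <- i :: r) P j x) = fun x => P i x + \sum_(j <- r) P j x.
Proof. by apply/funext => x; rewrite big_cons. Qed.

Lemma is_euler_derive_sum (R : realType) (I : eqType) (r : seq I)
    (P Q : I -> R -> R) :
  (forall i, i \in r -> is_euler_derive R (P i) (Q i)) ->
  is_euler_derive R (fun x => \sum_(i <- r) P i x) (fun x => \sum_(i <- r) Q i x).
Proof.
elim: r => [|i r IH] h.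
  rewrite (funext (fun x => big_nil _ _ _ (P^~ x))).
  by move=> x _; apply: (is_derive_eq (is_derive_cst 0 x 1)); rewrite big_nil mul0r.
rewrite !big_cons_fun.
apply: is_euler_deriveD; first by apply: h; rewrite mem_head.
by apply: IH => j jr; apply: h; rewrite in_cons jr orbT.
Qed.

Lemma half_square_primitive_sum (R : realType) (I : eqType) (r : seq I)
    (E : R -> R) (phi Psi : I -> R -> R) :
  (forall x, ee R <= x -> 0 <= E x) ->
  (forall i, i \in r -> half_square_primitive R E (phi i) (Psi i)) ->
  half_square_primitive R E (fun x => \sum_(i <- r) phi i x)
    (fun x => \sum_(i <- r) Psi i x).
Proof.
move=> E0; elim: r => [|i r IH] h.
  exists (fun=> 0), (fun=> 0).
  rewrite (funext (fun x => big_nil _ _ _ (phi^~ x))).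
  rewrite (funext (fun x => big_nil _ _ _ (Psi^~ x))).
  have d0 : is_euler_derive R (fun=> 0) (fun=> 0).
    by move=> x _; apply: (is_derive_eq (is_derive_cst 0 x 1)); rewrite mul0r.
  split => //; exists 0; split => // x hx.
  - by rewrite normr0 mul0r.
  - by rewrite normr0 mul0r.
  - by rewrite ?big_nil !mul0r addr0 subrr normr0.
rewrite !big_cons_fun.
apply: half_square_primitiveD; first by apply: h; rewrite mem_head.
by apply: IH => j jr; apply: h; rewrite in_cons jr orbT.
Qed.

(** The truncated Neumann series: as theta T_j = - T_(j+1), applying 1 + theta/2 to the sum of the
    T_j / 2^j telescopes to T_0 - T_n / 2^n, so only T_n has to be dominated by E. *)
Lemma half_square_primitive_chain (R : realType) (E : R -> R) (n : nat)
    (T : nat -> R -> R) :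
  (forall x, ee R <= x -> 0 <= E x) ->
  (forall j, is_euler_derive R (T j) (fun x => - T j.+1 x)) ->
  dominated R (T 0%N) (loglog_mono R 0 0) ->
  dominated R (T 1%N) (loglog_mono R 0 0) ->
  dominated R (T n) E ->
  half_square_primitive R E (T 0%N) (fun x => \sum_(0 <= j < n) T j x / 2 ^+ j).
Proof.
move=> E0 dT b0 b1 bn.
exists (fun x => - T 1%N x), (fun x => \sum_(0 <= j < n) - T j.+1 x / 2 ^+ j).
split => //.
- apply: is_euler_derive_sum => j _.
  move=> x hx.
  have := is_euler_deriveZ R (2 ^+ j)^-1 _ _ (dT j) x hx.
  rewrite (funext (fun y => mulrC (2 ^+ j)^-1 (T j y))) => h.
  by apply: (is_derive_eq h); rewrite [_^-1 * _]mulrC.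
- by rewrite -(funext (fun x => mulN1r (T 1%N x))); exact: dominatedZ.
- rewrite (_ : (fun x => _) = (fun x => (- (2 ^+ n)^-1) * T n x)).
    exact: dominatedZ.
  apply/funext => x; rewrite mulr_suml -big_split /=.
  rewrite (eq_bigr (fun j => - T j.+1 x / 2 ^+ j.+1 - - T j x / 2 ^+ j)); last first.
    move=> j _; rewrite exprS; field; by rewrite expf_neq0.
  rewrite telescope_sumr // expr0; field; by rewrite expf_neq0.
Qed.

(** * The coefficients b_{s,i,j,r} and the iterates of -theta on l^i / L^s *)

Lemma b_coef_gt (s i j r : nat) : (j < r)%N -> b_coef s i j r = 0.
Proof.
elim: j r => [|j IH] [|r] //= h.
by rewrite gtn_eqF // ltnNge ltnW.
Qed.

(** The zero dummies merge the clauses of the recursion into one: on the diagonal the first term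
    vanishes, beyond it both do. *)
Lemma b_coefSS (s i j r : nat) :
  b_coef s i j.+1 r.+1 =
  b_coef s i j r.+1 * (s%:Z + j%:Z) + b_coef s i j r * (- i%:Z + r%:Z).
Proof.
rewrite [LHS]/=; case: eqVneq => [->|neq].
  by rewrite (b_coef_gt s i j j.+1) // mul0r add0r.
case: ltnP => // h.
have jr : (j < r)%N by rewrite ltn_neqAle eq_sym neq.
by rewrite (b_coef_gt _ _ _ _ jr) (b_coef_gt _ _ _ r.+1) ?mul0r ?addr0 // (ltn_trans jr).
Qed.

(* (-theta)^j (l^i / L^s); the coefficients with r > j vanish. *)
Definition loglog_chain (R : realType) (s i j : nat) (x : R) : R :=
  \sum_(0 <= r < i.+1) (b_coef s i j r)%:~R * loglog_mono R (i - r) (s + j).+1 x.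

Lemma loglog_chain0 (R : realType) (s i : nat) :
  loglog_chain R s i 0 = loglog_mono R i s.+1.
Proof.
apply/funext => x; rewrite /loglog_chain big_nat_recl //= big1 ?addr0.
  by rewrite mul1r subn0 addn0.
by move=> r _; rewrite mul0r.
Qed.

(** Applying -theta to l^(i-r) / L^(s+j) gives s+j times l^(i-r) / L^(s+j+1) and -i+r times
    l^(i-r-1) / L^(s+j+1); collecting equal powers of l is the recursion for b. *)
Lemma is_euler_derive_loglog_chain (R : realType) (s i j : nat) :
  is_euler_derive R (loglog_chain R s i j) (fun x => - loglog_chain R s i j.+1 x).
Proof.
have -> : (fun x => - loglog_chain R s i j.+1 x) = (fun x =>
  \sum_(0 <= r < i.+1) (b_coef s i j r)%:~R *
    ((i - r)%:R * loglog_mono R (i - r).-1 (s + j).+2 x +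
    (1 - (s + j).+1%:R) * loglog_mono R (i - r) (s + j).+2 x)).
  apply/funext => x; rewrite /loglog_chain addnS.
  rewrite -sumrN.
  (* [A] collects the derivatives of the powers of l, [D] those of the powers of L. [A i] is zero,
     which allows the shift of index by one. *)
  pose A r : R := (b_coef s i j r)%:~R * (i%:R - r%:R) *
    loglog_mono R (i - r.+1) (s + j).+2 x.
  pose D r : R := (b_coef s i j r)%:~R * (- (s + j)%:R) *
    loglog_mono R (i - r) (s + j).+2 x.
  transitivity (\sum_(0 <= r < i.+1) A r + \sum_(0 <= r < i.+1) D r).
    have -> : \sum_(0 <= r < i.+1) A r = \sum_(0 <= r < i) A r.
      by rewrite big_nat_recr //= /A subrr mulr0 mul0r addr0.
    rewrite [LHS]big_nat_recl // [X in _ = _ + X]big_nat_recl //.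
    rewrite [RHS]addrCA -big_split; congr (_ + _).
      rewrite /D /= subn0 intrM intrD natrD; ring.
    apply: eq_bigr => r _; rewrite /A /D b_coefSS.
    rewrite intrD !intrM !intrD intrN natrD -!pmulrn /=; ring.
  rewrite -big_split /=; apply: eq_big_nat => r /andP[_ ri].
  rewrite /A /D subnS -natr1 natrB //; ring.
apply: is_euler_derive_sum => r _.
apply: is_euler_deriveZ; exact: is_euler_derive_loglog_mono.
Qed.

Lemma half_square_primitive_loglog_mono (R : realType) (m s i : nat) :
  (i <= s <= m)%N ->
  half_square_primitive R (loglog_mono R m.+1 m.+2) (loglog_mono R i s.+1)
    (fun x => \sum_(0 <= j < (m - s).+1) loglog_chain R s i j x / 2 ^+ j).
Proof.
move=> /andP[ls sm].
rewrite -(loglog_chain0 R s i); apply: half_square_primitive_chain.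
- by move=> x; exact: loglog_mono_ge0.
- exact: is_euler_derive_loglog_chain.
- by rewrite loglog_chain0; apply: dominated_loglog_mono_ln; rewrite (leq_trans ls).
- apply: dominated_sum => [x|r _]; first exact: loglog_mono_ge0.
  apply: dominatedZ; apply: dominated_loglog_mono_ln.
  by rewrite (leq_trans (leq_subr _ _)) // (leq_trans ls) // addn1 ltnW.
- apply: dominated_sum => [x|r _]; first exact: loglog_mono_ge0.
  apply: dominatedZ; apply: dominated_loglog_mono.
    by rewrite (leq_trans (leq_subr _ _)) // (leq_trans ls) // ltnW.
  by rewrite addnS subnKC.
Qed.

(** * The leading terms ln x, ln (ln x) and the constant *)

(** The chain L, -1, 0 stops, so there is no error. The difference phi - Psi = 1/2 is the source of
    the term n^2 / 4. *)
Lemma half_square_primitive_ln (R : realType) (E : R -> R) :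
  (forall x, ee R <= x -> 0 <= E x) ->
  half_square_primitive R E (loglog_mono R 0 0)
    (fun x => loglog_mono R 0 0 x - loglog_mono R 0 1 x / 2).
Proof.
move=> E0.
pose T j := match j with 0 => loglog_mono R 0 0
  | 1 => (fun x => -1 * loglog_mono R 0 1 x) | _ => fun=> 0 end.
rewrite (_ : (fun x => _ - _) =
  fun x => \sum_(0 <= j < 2) T j x / 2 ^+ j); last first.
  by apply/funext => x; rewrite !big_nat_recr //= big_nil; field.
apply: (half_square_primitive_chain R E 2 T) => //.
- case=> [|[|j]] /=.
  + move=> x hx; apply: (is_derive_eq (is_euler_derive_loglog_mono R 0 0 x hx)).
    by rewrite /=; ring.
  + apply: (_ : is_euler_derive R _ (fun x => - 0)) => x hx.
    apply: (is_derive_eq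
      (is_euler_deriveZ R (-1) _ _ (is_euler_derive_loglog_mono R 0 1) x hx)).
    by rewrite subrr; ring.
  + move=> x _; apply: (is_derive_eq (is_derive_cst 0 x 1)).
    by rewrite oppr0 mul0r.
- exact: dominated_loglog_mono_ln.
- exact/dominatedZ/dominated_loglog_mono_ln.
- by exists 0; split => // x _; rewrite normr0 mul0r.
Qed.

(** Here (-theta)^j l = - (j-1)! / L^j for j >= 1, so phi - Psi is exactly h_m. *)
Lemma half_square_primitive_lnln (R : realType) (m : nat) :
  half_square_primitive R (loglog_mono R m.+1 m.+2) (loglog_mono R 1 1)
    (fun x => loglog_mono R 1 1 x -
      \sum_(1 <= j < m.+1) (j.-1)`!%:R * loglog_mono R 0 j.+1 x / 2 ^+ j).
Proof.
pose T j := match j with 0 => loglog_mono R 1 1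
  | j'.+1 => fun x => - j'`!%:R * loglog_mono R 0 j'.+2 x end.
rewrite (_ : (fun x => _ - _) =
  fun x => \sum_(0 <= j < m.+1) T j x / 2 ^+ j); last first.
  apply/funext => x; rewrite [RHS]big_nat_recl // expr0 divr1 big_add1 /= -sumrN.
  by congr (_ + _); apply: eq_bigr => j _; rewrite !mulNr.
apply: (half_square_primitive_chain R _ m.+1 T).
- by move=> x; exact: loglog_mono_ge0.
- case=> [|j] /= x hx.
    apply: (is_derive_eq (is_euler_derive_loglog_mono R 1 1 x hx)).
    by rewrite subrr /= fact0; ring.
  apply: (is_derive_eq
    (is_euler_deriveZ R _ _ _ (is_euler_derive_loglog_mono R 0 j.+2) x hx)).
  rewrite factS natrM -!natr1 /=; ring.
- exact: dominated_loglog_mono_ln.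
- exact/dominatedZ/dominated_loglog_mono_ln.
- exact/dominatedZ/dominated_loglog_mono.
Qed.

Lemma half_square_primitive_cst (R : realType) (E : R -> R) :
  (forall x, ee R <= x -> 0 <= E x) ->
  half_square_primitive R E (loglog_mono R 0 1) (loglog_mono R 0 1).
Proof.
move=> E0; exists (fun=> 0), (fun=> 0).
have d0 : is_euler_derive R (loglog_mono R 0 1) (fun=> 0).
  move=> x hx; apply: (is_derive_eq (is_euler_derive_loglog_mono R 0 1 x hx)).
  by rewrite subrr; ring.
split => //; first exact: dominated_loglog_mono_ln.
  by exists 0; split => // x _; rewrite normr0 mul0r.
by exists 0; split => // x _; rewrite mul0r addr0 subrr normr0 mul0r.
Qed.

(** * Derivatives of x P(x) and x^2 P(x) / 2, and the growth of the error term *)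

Lemma is_euler_derive_mulx (R : realType) (P Q : R -> R) :
  is_euler_derive R P Q ->
  forall x, ee R <= x -> is_derive x 1 (fun y => y * P y) (P x + Q x).
Proof.
move=> h x hx; have [x0 _ _] := ee_le _ _ hx.
apply: (is_derive_eq (is_deriveM (is_derive_id x 1) (h x hx))).
by rewrite /GRing.scale /= mulr1 mulrC divfK ?gt_eqF // addrC.
Qed.

Lemma is_euler_derive_half_square (R : realType) (P Q : R -> R) :
  is_euler_derive R P Q -> forall x, ee R <= x ->
  is_derive x 1 (fun y => y ^+ 2 / 2 * P y) (x * (P x + Q x / 2)).
Proof.
move=> h x hx; have [x0 _ _] := ee_le _ _ hx.
have d := is_deriveM (is_derive_id x (1 : R))
  (is_euler_derive_mulx _ _ _ (is_euler_deriveZ _ 2^-1 _ _ h) x hx).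
rewrite (_ : (fun y => _) = id * (fun y : R => y * (2^-1 * P y))); last first.
  by apply/funext => y; rewrite !fctE; field.
by apply: (is_derive_eq d); rewrite /GRing.scale /=; field.
Qed.

Lemma MVT_ge (R : realType) (f df : R -> R) (X a b : R) :
  (forall x, X <= x -> is_derive x 1 f (df x)) -> X <= a -> a <= b ->
  exists c, [/\ a <= c, c <= b & f b - f a = df c * (b - a)].
Proof.
move=> d Xa ab.
have [||c] := @MVT_segment R f df a b ab.
- by move=> x; rewrite in_itv /= => /andP[/ltW ax _]; exact: d (le_trans Xa ax).
- apply: derivable_within_continuous => x; rewrite in_itv /= => /andP[ax _].
  by have := d x (le_trans Xa ax) => dx; exact: ex_derive.
by rewrite in_itv /= => /andP[ac cb] e; exists c.
Qed.

(** The derivative is l^(m+1) / L^(m+1) times 1 - (m+1)/L, plus a nonnegative term; the threshold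
    e^(m+1) gives L >= m+1. *)
Lemma loglog_mono_mulx_homo (R : realType) (m : nat) (x y : R) :
  Num.max (ee R) (expR m.+1%:R) <= x -> x <= y ->
  x * loglog_mono R m.+1 m.+2 x <= y * loglog_mono R m.+1 m.+2 y.
Proof.
move=> hx xy; rewrite -subr_ge0.
have ex : ee R <= x by move: hx; rewrite ge_max => /andP[].
have [c [xc cy ->]] := MVT_ge R _ _ _ _ _ (is_euler_derive_mulx R _ _
  (is_euler_derive_loglog_mono R m.+1 m.+2)) ex xy.
apply: mulr_ge0; last by rewrite subr_ge0.
have := le_trans hx xc; rewrite ge_max => /andP[hc mc].
have [c0 L1 _] := ee_le _ _ hc; have L0 : 0 < ln c := lt_trans ltr01 L1.
have mL : m.+1%:R <= ln c by rewrite -ler_expR lnK.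
rewrite addrCA; apply: addr_ge0; first by apply: mulr_ge0 => //; exact: loglog_mono_ge0.
have e : loglog_mono R m.+1 m.+3 c = loglog_mono R m.+1 m.+2 c / ln c.
  by rewrite !loglog_monoS // [ln c ^+ m.+2]exprS; field; rewrite expf_neq0 gt_eqF.
rewrite e -[m.+2%:R]natr1.
rewrite (_ : _ + _ = loglog_mono R m.+1 m.+2 c * (1 - m.+1%:R / ln c)).
  apply: mulr_ge0; first exact: loglog_mono_ge0.
  by rewrite subr_ge0 ler_pdivrMr // mul1r.
by field; rewrite gt_eqF.
Qed.

(* From 1 + y <= exp y at y = ln x / n. *)
Lemma ln_expn_le (R : realType) (n : nat) (x : R) :
  (0 < n)%N -> 1 <= x -> ln x ^+ n <= n%:R ^+ n * x.
Proof.
move=> n0 x1; have x0 : 0 < x := lt_le_trans ltr01 x1.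
have l0 : 0 <= ln x := ln_ge0 x1.
have nn : (0 : R) < n%:R by rewrite ltr0n.
have -> : ln x ^+ n = n%:R ^+ n * (ln x / n%:R) ^+ n.
  by rewrite -exprMn mulrC divfK // gt_eqF.
apply: ler_wpM2l; first by rewrite exprn_ge0 // ltW.
rewrite -[leRHS]lnK // -[ln x in leRHS](@divfK _ n%:R) ?gt_eqF //.
rewrite [_ / _ * _]mulrC expRM_natl lerXn2r ?nnegrE ?expR_ge0 ?divr_ge0 ?(ltW nn) //.
by have := expR_ge1Dx (ln x / n%:R); lra.
Qed.

(** Follows from L^(m+2) = O(x) and l >= 1. It lets the error term absorb quantities of size O(ln
    x), and constants. *)
Lemma dominated_ln_loglog_mono_mulx (R : realType) (m : nat) :
  dominated R (loglog_mono R 0 0) (fun x => x * loglog_mono R m.+1 m.+2 x).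
Proof.
exists (m.+2%:R ^+ m.+2); split; first by rewrite exprn_ge0.
move=> x hx; have [x0 L1 l1] := ee_le _ _ hx; have L0 : 0 < ln x := lt_trans ltr01 L1.
have x1 : 1 <= x.
  by rewrite -ler_ln ?posrE // ln1 ltW.
rewrite ger0_norm ?loglog_mono_ge0 // loglog_monoS //.
rewrite /loglog_mono expr0 mul1r divr1 !mulrA ler_pdivlMr ?exprn_gt0 // -exprS.
apply: le_trans (ln_expn_le R m.+2 x isT x1) _.
by rewrite ler_peMr ?exprn_ege1 // mulr_ge0 ?exprn_ge0 // ltW.
Qed.

(** * Summation of a sequence with a smooth approximation *)

Lemma half_sum_asymptotics (R : realType) (m : nat) (phi Psi : R -> R)
    (p : nat -> R) (C : R) (N : nat) :
  let c (n : nat) := n%:R * loglog_mono R m.+1 m.+2 n%:R in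
  half_square_primitive R (loglog_mono R m.+1 m.+2) phi Psi -> 0 <= C ->
  (forall n, (N <= n)%N -> `|p n - n%:R * phi n%:R| <= C * c n) ->
  exists C' N', forall n, (N' <= n)%N ->
    `|n%:R * p n / 2 - \sum_(1 <= k < n.+1) p k
      - n%:R ^+ 2 / 2 * (phi n%:R - Psi n%:R)| <= C' * (n%:R * c n).
Proof.
move=> c [dphi [dPsi [hphi hPsi [A [A0 hA]] [A' [A'0 hA']] [D [D0 hD]]]]] C0 hp.
have [K [K0 hK]] := dominated_ln_loglog_mono_mulx R m.
pose X := Num.max (ee R) (expR m.+1%:R).
pose M := maxn N (Num.bound X).
have XM n : (M <= n)%N -> X <= n%:R.
  rewrite geq_max => /andP[_ hn]; apply: (@le_trans _ _ (Num.bound X)%:R).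
    by rewrite ltW // archi_boundP // le_max expR_ge0.
  by rewrite ler_nat.
have eX x : X <= x -> ee R <= x by rewrite ge_max => /andP[].
have c0 n : (M <= n)%N -> 0 <= c n.
  by move=> hn; rewrite mulr_ge0 // loglog_mono_ge0 // eX // XM.
pose G x := x ^+ 2 / 2 * Psi x.
(* [D] pays for the defect of Psi, [(A + A') * K] for the variation of x phi(x) on a unit interval,
   [C] for the approximation of p. *)
pose C1 := D + (A + A') * K + C.
have step n : (M <= n)%N -> `|p n.+1 - (G n.+1%:R - G n%:R)| <= C1 * c n.+1.
  move=> Mn; have Xn := XM n Mn.
  have nn : n%:R <= n.+1%:R :> R by rewrite ler_nat.
  have n1 : n.+1%:R - n%:R = 1 :> R by rewrite -natr1; ring.
  have [t [nt tn e]] := MVT_ge R _ _ _ _ _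
    (is_euler_derive_half_square R _ _ hPsi) (eX _ Xn) nn.
  have Xt := le_trans Xn nt; have [t0 _ _] := ee_le _ _ (eX _ Xt).
  (* The first mean value produces t phi(t) up to an error; a second one, for x phi(x) on [t, n+1],
     moves it to the endpoint n+1. *)
  have [u [tu un e']] := MVT_ge R _ _ _ _ _
    (is_euler_derive_mulx R _ _ hphi) (eX _ Xt) tn.
  have Xu := le_trans Xt tu.
  rewrite /G e n1 mulr1.
  rewrite (_ : _ - _ = (p n.+1 - n.+1%:R * phi n.+1%:R)
    + ((n.+1%:R * phi n.+1%:R - t * phi t)
    - t * (Psi t + dPsi t / 2 - phi t))); last by field.
  have h1 : `|p n.+1 - n.+1%:R * phi n.+1%:R| <= C * c n.+1.
    by apply: hp; rewrite (leq_trans (leq_maxl _ _) (leq_trans Mn _)).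
  have h2 : `|n.+1%:R * phi n.+1%:R - t * phi t| <= (A + A') * K * c n.+1.
    rewrite e' normrM [`|_ - t|]ger0_norm ?subr_ge0 //.
    have hu : `|phi u + dphi u| <= (A + A') * K * c n.+1.
      apply: le_trans (ler_normD _ _) _.
      apply: le_trans (lerD (hA u (eX _ Xu)) (hA' u (eX _ Xu))) _.
      rewrite -mulrDl -[leRHS]mulrA; apply: ler_wpM2l; first exact: addr_ge0.
      have := hK u (eX _ Xu); rewrite ger0_norm ?loglog_mono_ge0 ?eX // => /le_trans.
      apply; apply: ler_wpM2l => //.
      exact: loglog_mono_mulx_homo.
    apply: le_trans hu; rewrite ler_piMr //.
    lra.
  have h3 : `|t * (Psi t + dPsi t / 2 - phi t)| <= D * c n.+1.
    rewrite normrM gtr0_norm //.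
    apply: le_trans (ler_wpM2l (ltW t0) (hD t (eX _ Xt))) _.
    rewrite mulrCA; apply: ler_wpM2l => //.
    exact: loglog_mono_mulx_homo.
  apply: le_trans (ler_normD _ _) _.
  apply: le_trans (lerD h1 (ler_normB _ _)) _.
  apply: le_trans (lerD (lexx _) (lerD h2 h3)) _.
  by rewrite /C1 le_eqVlt; apply/orP; left; apply/eqP; ring.
pose S n := \sum_(1 <= k < n.+1) p k.
pose B := `|S M - G M%:R|.
have C10 : 0 <= C1 by rewrite !addr_ge0 // mulr_ge0 // addr_ge0.
(* Induction on k: c(n) <= c(n+1) gives n c(n) + c(n+1) <= (n+1) c(n+1). [B] holds the discrepancy
   at the start [M]. *)
have sums k : `|S (M + k)%N - G (M + k)%:R| <=
    B + C1 * ((M + k)%:R * c (M + k)%N).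
  elim: k => [|k IH].
    by rewrite addn0 lerDl mulr_ge0 // mulr_ge0 // c0.
  rewrite addnS; set n := (M + k)%N in IH *.
  have Mn : (M <= n)%N by exact: leq_addr.
  rewrite /S big_nat_recr //= -/(S n).
  rewrite (_ : _ - _ = (S n - G n%:R) + (p n.+1 - (G n.+1%:R - G n%:R))); last by ring.
  apply: le_trans (ler_normD _ _) _; apply: le_trans (lerD IH (step n Mn)) _.
  rewrite -addrA lerD2l -mulrDr; apply: ler_wpM2l => //.
  rewrite -[n.+1%:R in leRHS]natr1 mulrDl mul1r lerD2r ler_wpM2l //.
  apply: loglog_mono_mulx_homo; first exact: XM.
  by rewrite ler_nat.
(* [C / 2] comes from replacing p by n phi(n) in n p(n) / 2; [B * K] absorbs the constant [B], as 1
   <= ln n <= K c(n) <= K n c(n). *)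
exists (C / 2 + (B * K + C1)), M => n Mn.
have Xn := XM n Mn; have [n0 L1 l1] := ee_le _ _ (eX _ Xn).
have n1 : 1 <= n%:R :> R by rewrite ler1n -(ltr0n R).
have := sums (n - M)%N; rewrite subnKC // => hS.
rewrite (_ : _ - _ - _ = n%:R / 2 * (p n - n%:R * phi n%:R)
  - (S n - G n%:R)); last by rewrite /G /S; field.
apply: le_trans (ler_normB _ _) _; rewrite mulrDl; apply: lerD.
  rewrite normrM ger0_norm ?divr_ge0 //.
  have hn : (N <= n)%N by exact: leq_trans (leq_maxl _ _) Mn.
  apply: le_trans (ler_wpM2l _ (hp n hn)) _; first by rewrite divr_ge0.
  by rewrite le_eqVlt; apply/orP; left; apply/eqP; field.
apply: le_trans hS _; rewrite [leRHS]mulrDl lerD2r -mulrA; apply: ler_peMr; first exact: normr_ge0.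
have := hK n%:R (eX _ Xn); rewrite ger0_norm ?loglog_mono_ge0 ?eX //.
rewrite [loglog_mono R 0 0 _]/loglog_mono expr0 mul1r divr1 => h.
apply: le_trans (ltW L1) _; apply: le_trans h _.
by apply: ler_wpM2l => //; rewrite ler_peMl // c0.
Qed.

(** * Application to Cipolla's expansion *)

(** Reconciles the range r <= min(i,j) of the theorem with the range r <= i of [loglog_chain]: the
    extra terms have r > j. *)
Lemma big_b_coef_min (R : realType) (s i j : nat) (F : nat -> R) :
  \sum_(0 <= r < (minn i j).+1) (b_coef s i j r)%:~R * F r =
  \sum_(0 <= r < i.+1) (b_coef s i j r)%:~R * F r.
Proof.
rewrite [RHS](@big_cat_nat _ _ _ (minn i j).+1) //= ?ltnS ?geq_minl //.
rewrite [X in _ = _ + X]big_nat_cond [X in _ = _ + X]big1 ?addr0 //.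
move=> r /andP[/andP[mr ri] _]; rewrite b_coef_gt ?mul0r //.
by move: mr; rewrite gtn_min ltnNge -ltnS ri.
Qed.

(** By linearity from the single terms of Cipolla's bracket: L, l, -1 and the combinations of l^i /
    L^s. *)
Lemma half_square_primitive_cipolla (R : realType) (m : nat)
    (a : nat -> nat -> rat) :
  half_square_primitive R (loglog_mono R m.+1 m.+2)
    (fun x => loglog_mono R 0 0 x + loglog_mono R 1 1 x
      + -1 * loglog_mono R 0 1 x
      + \sum_(1 <= s < m.+1) (-1) ^+ s.+1 / s%:R *
          \sum_(0 <= i < s.+1) ratr (a i s) * loglog_mono R i s.+1 x)
    (fun x => (loglog_mono R 0 0 x - loglog_mono R 0 1 x / 2)
      + (loglog_mono R 1 1 x -
          \sum_(1 <= j < m.+1) (j.-1)`!%:R * loglog_mono R 0 j.+1 x / 2 ^+ j)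
      + -1 * loglog_mono R 0 1 x
      + \sum_(1 <= s < m.+1) (-1) ^+ s.+1 / s%:R *
          \sum_(0 <= i < s.+1) ratr (a i s) *
            \sum_(0 <= j < (m - s).+1) loglog_chain R s i j x / 2 ^+ j).
Proof.
have E0 x : ee R <= x -> 0 <= loglog_mono R m.+1 m.+2 x by exact: loglog_mono_ge0.
apply: half_square_primitiveD.
  apply: half_square_primitiveD.
    apply: half_square_primitiveD; first exact: half_square_primitive_ln.
    exact: half_square_primitive_lnln.
  exact/half_square_primitiveZ/half_square_primitive_cst.
apply: half_square_primitive_sum => // s; rewrite mem_index_iota => /andP[_ sm].
apply: half_square_primitiveZ.
apply: half_square_primitive_sum => // i; rewrite mem_index_iota => /= lis.
apply: half_square_primitiveZ.
by apply: half_square_primitive_loglog_mono; rewrite -ltnS lis -ltnS.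
Qed.

Theorem theorem3p1 (R : realType) (m : nat) (hm : (0 < m)%N)
    (a : nat -> nat -> rat) (ha : cipolla_coefficients R m a) :
  (fun n => B_seq R n) =
  (fun n => n%:R ^+ 2 / 4 + n%:R ^+ 2 / 2 * h_sum R m n
     + n%:R ^+ 2 / 2 *
       \sum_(1 <= s < m.+1) (-1) ^+ s / (s%:R * ln n%:R ^+ s) *
         \sum_(0 <= i < s.+1) ratr (a i s) *
           \sum_(1 <= j < (m - s).+1)
             \sum_(0 <= r < (minn i j).+1)
               (b_coef s i j r)%:~R * ln (ln n%:R) ^+ (i - r)
                 / (2 ^+ j * ln n%:R ^+ j))
  +O_\oo (fun n => n%:R * c_err R m n).
Proof.
have [_ /eqaddOP hO] := ha.
(* The constant of the O is chosen nonnegative, as the summation requires. *)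
have [C [C0 hC]] : exists C : R, 0 <= C /\ \forall n \near \oo,
    `|((fun n => (nth_prime n)%:R : R) - (fun n => n%:R * (ln n%:R + ln (ln n%:R) - 1
     + \sum_(1 <= s < m.+1) (-1) ^+ s.+1 / (s%:R * ln n%:R ^+ s)
         * \sum_(0 <= i < s.+1) ratr (a i s) * ln (ln n%:R) ^+ i))) n|
     <= C * `|c_err R m n|.
  have [C [hC C0]] := filter_ex (filterI hO (nbhs_pinfty_ge (num_real 0))).
  by exists C.
have [N0 _ hN0] := hC.
pose N := maxn N0 (Num.bound (ee R)).
have Nee n : (N <= n)%N -> ee R <= n%:R.
  rewrite geq_max => /andP[_ hn]; apply: (@le_trans _ _ (Num.bound (ee R))%:R).
    by rewrite ltW // archi_boundP // expR_ge0.
  by rewrite ler_nat.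
have cE n : (N <= n)%N -> c_err R m n = n%:R * loglog_mono R m.+1 m.+2 n%:R.
  by move=> /Nee en; rewrite loglog_monoS // mulrA.
have L_neq0 n : (N <= n)%N -> ln (n%:R : R) != 0.
  by move=> /Nee /ee_le[_ L1 _]; rewrite gt_eqF // (lt_trans ltr01).
have [|C' [N' hN']] := half_sum_asymptotics R m _ _
  (fun n => (nth_prime n)%:R) C N (half_square_primitive_cipolla R m a) C0.
  move=> n Nn; have := hN0 n (leq_trans (leq_maxl _ _) Nn).
  rewrite !fctE cE // [in leRHS]ger0_norm; last first.
    by apply: mulr_ge0 => //; apply: loglog_mono_ge0; exact: Nee.
  congr (`|_ - _ * _| <= _).
  rewrite !loglog_monoS ?Nee // {1}/loglog_mono !expr0 !expr1 !divr1 mul1r mulN1r.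
  congr (_ + _); apply: eq_bigr => s _.
  rewrite invfM mulrA -[LHS]mulrA; congr (_ * _); rewrite mulr_sumr.
  by apply: eq_bigr => i _; rewrite loglog_monoS ?Nee // mulrCA [_^-1 * _]mulrC.
apply/eqaddOP; near=> k; near=> n.
have Nn : (N <= n)%N by near: n; exact: nbhs_infty_ge.
have N'n : (N' <= n)%N by near: n; exact: nbhs_infty_ge.
have ln0 := L_neq0 n Nn.
have en := Nee n Nn.
have cn0 : 0 <= n%:R * (n%:R * loglog_mono R m.+1 m.+2 n%:R).
  by do 2![apply: mulr_ge0 => //]; exact: loglog_mono_ge0.
rewrite !fctE cE // [in leRHS]ger0_norm //.
apply: (@le_trans _ _ (C' * (n%:R * (n%:R * loglog_mono R m.+1 m.+2 n%:R)))); last first.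
  apply: ler_wpM2r => //; near: k; exact: nbhs_pinfty_ge (num_real _).
move: (hN' n N'n); congr (`|_ - _| <= _).
have -> : h_sum R m n =
    \sum_(1 <= j < m.+1) (j.-1)`!%:R * loglog_mono R 0 j.+1 n%:R / 2 ^+ j.
  apply: eq_bigr => j _; rewrite loglog_monoS // expr0.
  by field; rewrite !expf_neq0.
set S := (X in _ = _ + _ * X).
set U := \sum_(1 <= s < m.+1) (_ / _ * _); set V := \sum_(1 <= s < m.+1) (_ / _ * _).
(* [U] and [V] are the lower-order parts of phi and Psi; the leading parts of phi - Psi already give
   1/2 + h_m(n). *)
suff -> : S = U - V.
  by rewrite (loglog_monoS R 0 0) // !expr0; field.
rewrite /U /V /S -sumrB; apply: eq_big_nat => s /andP[s1 sm].
rewrite -mulrBr -sumrB exprS !mulN1r !mulNr -mulrN -sumrN invfM mulrA -[LHS]mulrA.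
congr (_ * _); rewrite mulr_sumr; apply: eq_bigr => i _.
rewrite -mulrBr -mulrN mulrCA; congr (_ * _).
(* The term j = 0 of the chain is the monomial l^i / L^s itself and cancels against [U]; the
   remaining minus sign turns (-1)^(s+1) into (-1)^s. *)
rewrite [\sum_(0 <= j < (m - s).+1) _]big_nat_recl // expr0 divr1.
rewrite loglog_chain0 opprB addrAC subrr add0r.
rewrite big_add1 /= mulr_sumr; apply: eq_bigr => j _.
under eq_bigr do rewrite -mulrA.
rewrite big_b_coef_min /loglog_chain mulr_sumr mulr_suml.
apply: eq_bigr => r _; rewrite loglog_monoS // exprD.
by field; rewrite !expf_neq0.
Unshelve. all: by end_near.
Qed.
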